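(* Let the polynomials $R_i(x;\boldsymbol\rho)$ and the modified data $(\overline x,\overline{\boldsymbol\rho})$ be chosen such that $\lambda_{x,\boldsymbol\rho}=\zeta\lambda_{\overline x,\overline{\boldsymbol\rho}}-\xi$ for parameters $\zeta,\xi$. Then there are coefficients $\lambda^-_{x,\boldsymbol\rho}$ (independent of $i$) and $\Phi^{\epsilon,-}_i$, $\epsilon\in\{0,1,2\}$ (independent of $x$), with $\Phi_0^{0,-}\neq0$, such that $$\lambda^-_{x,\boldsymbol\rho} R_{i}(\overline x;\overline{\boldsymbol\rho})=\Phi_{i}^{0,-}R_{i}(x;\boldsymbol\rho) +\Phi_{i}^{1,-}R_{i+1}(x;\boldsymbol\rho)+\Phi_{i}^{2,-}R_{i+2}(x;\boldsymbol\rho),\qquad i\ge0,$$ if and only if, up to a global normalization, the coefficients are $$\lambda^-_{x,\boldsymbol\rho}=\left(1+\frac{(\zeta Y_{0,\overline{\boldsymbol\rho}}-Y_{0,\boldsymbol\rho}-\xi)(\lambda_{x,\boldsymbol\rho}-Y_{0,\boldsymbol\rho})}{X_{1,\boldsymbol\rho}}\right)+\left(1-\frac{(\lambda_{x,\boldsymbol\rho}-Y_{0,\boldsymbol\rho})(\lambda_{x,\boldsymbol\rho}-Y_{1,\boldsymbol\rho})}{X_{1,\boldsymbol\rho}}\right)\frac{X_{1,\boldsymbol\rho}-\zeta^2X_{1,\overline{\boldsymbol\rho}}+(\zeta Y_{0,\overline{\boldsymbol\rho}}-Y_{0,\boldsymbol\rho}-\xi)(\xi+Y_{1,\boldsymbol\rho}-\zeta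 Y_{0,\overline{\boldsymbol\rho}})}{X_{2,\boldsymbol\rho}},$$ $$\Phi_{i}^{0,-}=\zeta^i\prod_{k=1}^{i}\frac{C_{k,\overline{\boldsymbol\rho}}}{C_{k,\boldsymbol\rho}},\quad i\ge0,$$ $$\Phi_{i}^{2,-}=\zeta^{-i}\,\frac{(Y_{0,\boldsymbol\rho}-\zeta Y_{0,\overline{\boldsymbol\rho}}+\xi)(Y_{1,\boldsymbol\rho}-\zeta Y_{0,\overline{\boldsymbol\rho}}+\xi)+\zeta^2X_{1,\overline{\boldsymbol\rho}}-X_{1,\boldsymbol\rho}}{C_{1,\boldsymbol\rho}C_{2,\boldsymbol\rho}}\prod_{n=0}^{i-1}\frac{A_{n+2,\boldsymbol\rho}}{A_{n,\overline{\boldsymbol\rho}}},\quad i\ge0,$$ $$\Phi_{i}^{1,-}=\frac{X_{i+1,\boldsymbol\rho}-\zeta^2X_{i+1,\overline{\boldsymbol\rho}}}{C_{i+1,\boldsymbol\rho}(\zeta Y_{i,\overline{\boldsymbol\rho}}-Y_{i+1,\boldsymbol\rho}-\xi)}\Phi^{0,-}_{i}+\frac{X_{i+2,\boldsymbol\rho}-\zeta^2X_{i,\overline{\boldsymbol\rho}}}{A_{i+1,\boldsymbol\rho}(\zeta Y_{i,\overline{\boldsymbol\rho}}-Y_{i+1,\boldsymbol\rho}-\xi)}\Phi^{2,-}_{i},\quad i\ge0,$$ and the constraints $(\mathfrak C_{B'_2})$ are satisfied.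
   Context: $R_i(x;\boldsymbol\rho)$, $i=0,1,\dots,N$, denotes the polynomials of a finite family of the ($q$-)Askey scheme; $\boldsymbol\rho$ is the list of parameters, which includes the non-negative integer $N$. $R_i(x;\boldsymbol\rho)$ is a polynomial of degree $i$ in the variable $\lambda_{x,\boldsymbol\rho}$, normalized by $R_0(x;\boldsymbol\rho)=R_i(0;\boldsymbol\rho)=1$, and satisfies $$\lambda_{x,\boldsymbol\rho}R_i(x;\boldsymbol\rho)=A_{i,\boldsymbol\rho}R_{i+1}(x;\boldsymbol\rho)-(A_{i,\boldsymbol\rho}+C_{i,\boldsymbol\rho})R_i(x;\boldsymbol\rho)+C_{i,\boldsymbol\rho}R_{i-1}(x;\boldsymbol\rho),\qquad C_{0,\boldsymbol\rho}=0,\ A_{N,\boldsymbol\rho}=0.$$ $\overline{\boldsymbol\rho}$ is a list of modified parameters (of the same family) and $\overline x=x+\eta$ with $\eta\in\{0,+1,-1\}$. Notation: $X_{i,\boldsymbol\rho}:=A_{i-1,\boldsymbol\rho}C_{i,\boldsymbol\rho}$, $Y_{i,\boldsymbol\rho}:=-(A_{i,\boldsymbol\rho}+C_{i,\boldsymbol\rho})$, with $X_{0,\boldsymbol\rho}=0$; any term containing a vanishing factor $X_{0,\boldsymbol\rho}$, $X_{0,\overline{\boldsymbol\rho}}$ or the numerator $X_{0,\boldsymbol\rho}-\zeta^2X_{0,\overline{\boldsymbol\rho}}$ is read as $0$. Parameters are generic, so that the denominators which occur do not vanish. The constraints $(\mathfrak C_{B'_2})$: the two expressions $$\zeta^{2i}\frac{\frac{X_{i,\boldsymbol\rho}-\zeta^2X_{i,\overline{\boldsymbol\rho}}}{\zeta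 Y_{i-1,\overline{\boldsymbol\rho}}-Y_{i,\boldsymbol\rho}-\xi}-\frac{X_{i+1,\boldsymbol\rho}-\zeta^2X_{i+1,\overline{\boldsymbol\rho}}}{\zeta Y_{i,\overline{\boldsymbol\rho}}-Y_{i+1,\boldsymbol\rho}-\xi}+\zeta Y_{i,\overline{\boldsymbol\rho}}-Y_{i,\boldsymbol\rho}-\xi}{X_{i+1,\boldsymbol\rho}\frac{X_{i+2,\boldsymbol\rho}-\zeta^2X_{i,\overline{\boldsymbol\rho}}}{\zeta Y_{i,\overline{\boldsymbol\rho}}-Y_{i+1,\boldsymbol\rho}-\xi}-\zeta^2X_{i,\overline{\boldsymbol\rho}}\frac{X_{i+1,\boldsymbol\rho}-\zeta^2X_{i-1,\overline{\boldsymbol\rho}}}{\zeta Y_{i-1,\overline{\boldsymbol\rho}}-Y_{i,\boldsymbol\rho}-\xi}}\prod_{k=1}^{i}\frac{X_{k,\overline{\boldsymbol\rho}}}{X_{k,\boldsymbol\rho}},$$ $$\zeta^{2i}\frac{\frac{X_{i+1,\boldsymbol\rho}-\zeta^2X_{i+1,\overline{\boldsymbol\rho}}}{\zeta Y_{i,\overline{\boldsymbol\rho}}-Y_{i+1,\boldsymbol\rho}-\xi}-\frac{\zeta^2X_{i+1,\overline{\boldsymbol\rho}}}{X_{i+2,\boldsymbol\rho}}\frac{X_{i+2,\boldsymbol\rho}-\zeta^2X_{i+2,\overline{\boldsymbol\rho}}}{\zeta Y_{i+1,\overline{\boldsymbol\rho}}-Y_{i+2,\boldsymbol\rho}-\xi}}{\left(\frac{X_{i+3,\boldsymbol\rho}-\zeta^2X_{i+1,\overline{\boldsymbol\rho}}}{\zeta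 Y_{i+1,\overline{\boldsymbol\rho}}-Y_{i+2,\boldsymbol\rho}-\xi}-\frac{X_{i+2,\boldsymbol\rho}-\zeta^2X_{i,\overline{\boldsymbol\rho}}}{\zeta Y_{i,\overline{\boldsymbol\rho}}-Y_{i+1,\boldsymbol\rho}-\xi}+\zeta Y_{i,\overline{\boldsymbol\rho}}-Y_{i+2,\boldsymbol\rho}-\xi\right)X_{i+1,\boldsymbol\rho}}\prod_{k=1}^{i}\frac{X_{k,\overline{\boldsymbol\rho}}}{X_{k,\boldsymbol\rho}}$$ are equal and independent of $i$ for $i\ge0$.
   Formalization: ''i≥0'' is read as 0≤i≤N̄ (terms with R_{N+1}, R_{N+2} dropped, x on the grid for i≥N−1), and the relation also includes λ⁻_x=0 at those x in {0,…,N} with x̄ outside {0,…,N̄}; without it ''only if'' fails, e.g. N=2, N̄=0. *)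

(* Defs.v *)
(* Mathematical Components *)
From HB Require Import structures.
From mathcomp Require Import all_boot all_order all_algebra.
Set Implicit Arguments.
Unset Strict Implicit.
Unset Printing Implicit Defensive.
Import GRing.Theory.
Local Open Scope ring_scope.

(* The points x = 0, 1, ..., n *)
Definition grid (K : fieldType) (n : nat) : seq K :=
  [seq m%:R | m <- iota 0 n.+1].

(* The data attached to one (generic) list of parameters rho.
   R_i(x; rho) is the value of the polynomial [ff_R i] at lambda_{x, rho}.
   For i < N the recurrence is an identity in the free variable x.  For i = N
   the left-hand side has degree N + 1 while A_N = 0, so that it can only hold
   at the points x = 0, ..., N, whose images under lambda are the N + 1 roots
   of the characteristic polynomial of the recurrence.
   C_0 = 0 and A_N = 0 make the terms [ff_R 0.-1] and [ff_R N.+1] immaterial.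
   [ff_lambda_inj]: for generic parameters lambda separates the points
   -1, 0, ..., N + 1, that is, the points of the grid and their translates by
   eta in {0, 1, -1}. *)
Record finite_family (K : fieldType) := FiniteFamily {
  ff_N : nat;
  ff_lambda : K -> K;
  ff_A : nat -> K;
  ff_C : nat -> K;
  ff_R : nat -> {poly K};
  ff_C0 : ff_C 0%N = 0;
  ff_AN : ff_A ff_N = 0;
  ff_size : forall i, (i <= ff_N)%N -> size (ff_R i) = i.+1;
  ff_R0 : ff_R 0%N = 1;
  ff_R_at0 : forall i, (i <= ff_N)%N -> (ff_R i).[ff_lambda 0] = 1;
  ff_rec : forall (i : nat) (x : K), (i <= ff_N)%N ->
    (i < ff_N)%N \/ x \in grid K ff_N ->
    ff_lambda x * (ff_R i).[ff_lambda x] =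
      ff_A i * (ff_R i.+1).[ff_lambda x]
      - (ff_A i + ff_C i) * (ff_R i).[ff_lambda x]
      + ff_C i * (ff_R i.-1).[ff_lambda x];
  ff_lambda_inj : forall m n, (m <= ff_N.+2)%N -> (n <= ff_N.+2)%N ->
    ff_lambda (m%:R - 1) = ff_lambda (n%:R - 1) -> m = n
}.

Section Coefficients.
Variables (K : fieldType) (F : finite_family K).

(* R_i(x; rho), read as 0 when i > N: the family ends at R_N. *)
Definition Rval (i : nat) (x : K) : K :=
  if (i <= ff_N F)%N then (ff_R F i).[ff_lambda F x] else 0.

(* X_i = A_{i-1} C_i; X_0 = 0 because C_0 = 0. *)
Definition Xc (i : nat) : K := ff_A F i.-1 * ff_C F i.

Definition Yc (i : nat) : K := - (ff_A F i + ff_C F i).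

End Coefficients.

Section Contiguity.
Variables (K : fieldType).
(* F : data for rho;  G : data for rho-bar *)
Variables (F G : finite_family K) (zeta xi : K).

Local Notation N := (ff_N F).
Local Notation Nb := (ff_N G).
Local Notation A := (ff_A F).
Local Notation C := (ff_C F).
Local Notation Ab := (ff_A G).
Local Notation Cb := (ff_C G).
Local Notation X := (Xc F).
Local Notation Y := (Yc F).
Local Notation Xb := (Xc G).
Local Notation Yb := (Yc G).

(* zeta Y_{j, rho-bar} - Y_{k, rho} - xi *)
Definition Delta (j k : nat) : K := zeta * Yb j - Y k - xi.

(* Denominators and numerators of the two expressions of the constraints.
   With total division, every term that contains a vanishing factor X_0, Xb_0
   or the numerator X_0 - zeta^2 Xb_0 evaluates to 0 (whatever the value of
   the index i.-1 at i = 0).  The same holds at the upper end for the factors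
   X_{N+1} = A_N C_{N+1} and Xb_{Nb+1} = Ab_Nb Cb_{Nb+1}, so that no value of
   A, C, Ab, Cb outside the families contributes. *)
Definition constr1_num (i : nat) : K :=
  (X i - zeta ^+ 2 * Xb i) / Delta i.-1 i
  - (X i.+1 - zeta ^+ 2 * Xb i.+1) / Delta i i.+1
  + Delta i i.

Definition constr1_den (i : nat) : K :=
  X i.+1 * ((X i.+2 - zeta ^+ 2 * Xb i) / Delta i i.+1)
  - zeta ^+ 2 * Xb i * ((X i.+1 - zeta ^+ 2 * Xb i.-1) / Delta i.-1 i).

Definition constr2_num (i : nat) : K :=
  (X i.+1 - zeta ^+ 2 * Xb i.+1) / Delta i i.+1
  - zeta ^+ 2 * Xb i.+1 / X i.+2
    * ((X i.+2 - zeta ^+ 2 * Xb i.+2) / Delta i.+1 i.+2).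

Definition constr2_den (i : nat) : K :=
  ((X i.+3 - zeta ^+ 2 * Xb i.+1) / Delta i.+1 i.+2
   - (X i.+2 - zeta ^+ 2 * Xb i) / Delta i i.+1
   + Delta i i.+2) * X i.+1.

Definition constr1 (i : nat) : K :=
  zeta ^+ (2 * i) * (constr1_num i / constr1_den i)
  * \prod_(1 <= k < i.+1) (Xb k / X k).

Definition constr2 (i : nat) : K :=
  zeta ^+ (2 * i) * (constr2_num i / constr2_den i)
  * \prod_(1 <= k < i.+1) (Xb k / X k).

(* Both expressions are equal and independent of i >= 0.  The first one is
   attached to R_i(x-bar; rho-bar), 0 <= i <= Nb; the second one contains
   X_{i+2} as a denominator, hence 0 <= i <= N - 2. *)
Definition constraints_B2' : Prop :=
  exists kappa : K,
    (forall i, (i <= Nb)%N -> constr1 i = kappa) /\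
    (forall i, (i.+2 <= N)%N -> constr2 i = kappa).

(* Genericity: the denominators which occur do not vanish.
   - X_k occurs for k = 1, 2 (lambda^-), for k <= N (C_k in Phi^0, Phi^1 and
     Phi^2, X_{i+2} in the constraints) and for k <= Nb (products over
     k <= i <= Nb);
   - Ab_n occurs in Phi^2_i, i <= N - 2, for n < i.
   As A_N = 0 and Ab_Nb = 0, these two conditions force 2 <= N and
   N - 2 <= Nb <= N; see [generic_bounds]. *)
Record generic : Prop := Generic {
  gen_zeta : zeta != 0;
  gen_X : forall k, (0 < k)%N -> (k <= maxn 2 (maxn N Nb))%N -> X k != 0;
  gen_Ab : forall n, (n.+2 < N)%N -> Ab n != 0;
  gen_Delta : forall i, (i <= Nb)%N -> (i.+1 <= N)%N -> Delta i i.+1 != 0;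
  gen_constr1 : forall i, (i <= Nb)%N -> constr1_den i != 0;
  gen_constr2 : forall i, (i.+2 <= N)%N -> constr2_den i != 0
}.

Lemma generic_bounds : generic -> [/\ (2 <= N)%N, (N - 2 <= Nb)%N & (Nb <= N)%N].
Proof.
case=> _ hX hAb _ _ _.
have hN k : (k < maxn 2 (maxn N Nb))%N -> N != k.
  move=> hk; apply/eqP => eN.
  by have := hX k.+1 isT hk; rewrite /Xc /= -eN ff_AN mul0r eqxx.
have N2 : (2 <= N)%N.
  have h0 : N != 0 by apply: hN; rewrite leq_max.
  have h1 : N != 1 by apply: hN; rewrite leq_max.
  by case: N h0 h1 => [|[|n]].
split=> //.
- rewrite leqNgt; apply/negP; rewrite ltn_subRL add2n => hlt.
  by have := hAb _ hlt; rewrite ff_AN eqxx.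
- rewrite leqNgt; apply/negP => hlt.
  by have := hN N; rewrite !leq_max hlt !orbT eqxx => /(_ isT).
Qed.

(* lambda^-_x R_i(x-bar; rho-bar) = sum_{e = 0, 1, 2} Phi^e_i R_{i+e}(x; rho)
   for all the polynomials R_i(.; rho-bar), 0 <= i <= Nb:
   - if i + 2 <= N, then all four polynomials exist and x is a free variable;
   - if i = N - 1 or i = N, then R_{N+1}, R_{N+2} do not exist (their terms are
     0 by [Rval]), and x runs over the points 0, ..., N of the family.
   In a finite family R_i(x-bar; rho-bar), with its recurrence closed by
   Ab_Nb = 0, only lives at x-bar in {0, ..., Nb}; accordingly lambda^-_x is 0
   at the points x of {0, ..., N} such that x-bar is not one of them (without
   this the coefficients at i = Nb would not be determined: if Nb = 0, then
   any lambda^- in the span of R_0, R_1, R_2 would do). *)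
Definition contiguity_minus (eta : K) (lambdam : K -> K)
    (Phi0 Phi1 Phi2 : nat -> K) : Prop :=
  (forall (i : nat) (x : K), (i <= Nb)%N ->
     (i.+2 <= N)%N \/ x \in grid K N ->
     lambdam x * Rval G i (x + eta) =
       Phi0 i * Rval F i x + Phi1 i * Rval F i.+1 x + Phi2 i * Rval F i.+2 x)
  /\
  (forall x : K, x \in grid K N -> x + eta \notin grid K Nb -> lambdam x = 0).

Definition lambda_minus (x : K) : K :=
  (1 + (zeta * Yb 0 - Y 0 - xi) * (ff_lambda F x - Y 0) / X 1)
  + (1 - (ff_lambda F x - Y 0) * (ff_lambda F x - Y 1) / X 1)
    * ((X 1 - zeta ^+ 2 * Xb 1
        + (zeta * Yb 0 - Y 0 - xi) * (xi + Y 1 - zeta * Yb 0)) / X 2).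

Definition Phi0_minus (i : nat) : K :=
  zeta ^+ i * \prod_(1 <= k < i.+1) (Cb k / C k).

Definition Phi2_minus (i : nat) : K :=
  zeta ^- i
  * (((Y 0 - zeta * Yb 0 + xi) * (Y 1 - zeta * Yb 0 + xi)
      + zeta ^+ 2 * Xb 1 - X 1) / (C 1 * C 2))
  * \prod_(0 <= n < i) (A n.+2 / Ab n).

Definition Phi1_minus (i : nat) : K :=
  (X i.+1 - zeta ^+ 2 * Xb i.+1) / (C i.+1 * Delta i i.+1) * Phi0_minus i
  + (X i.+2 - zeta ^+ 2 * Xb i) / (A i.+1 * Delta i i.+1) * Phi2_minus i.

(* Phi^1_i at i = N - 1.  There A_{i+1} = A_N = 0 is both the denominator of
   the second term and a factor of Phi^2_i; this common factor is cancelled by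
   Phi^2_i = Phi^2_{i-1} A_{i+1} / (zeta Ab_{i-1}). *)
Definition Phi1_minus_last (i : nat) : K :=
  (X i.+1 - zeta ^+ 2 * Xb i.+1) / (C i.+1 * Delta i i.+1) * Phi0_minus i
  + (X i.+2 - zeta ^+ 2 * Xb i) / Delta i i.+1
    * (Phi2_minus i.-1 / (zeta * Ab i.-1)).

(* The coefficients are the displayed ones, up to the global factor c.
   Phi^1_i and Phi^2_i are prescribed as long as R_{i+1}, resp. R_{i+2}, exists. *)
Definition coefficients_minus (c : K) (lambdam : K -> K)
    (Phi0 Phi1 Phi2 : nat -> K) : Prop :=
  [/\ forall x : K, lambdam x = c * lambda_minus x,
      forall i, (i <= Nb)%N -> Phi0 i = c * Phi0_minus i,
      forall i, (i.+2 <= N)%N -> Phi2 i = c * Phi2_minus i,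
      forall i, (i.+2 <= N)%N -> Phi1 i = c * Phi1_minus i
    & forall i, (i <= Nb)%N -> i.+1 = N -> Phi1 i = c * Phi1_minus_last i].

End Contiguity.

(* Main.v *)
Require Import Defs.
From mathcomp Require Import all_boot all_order all_algebra.
From mathcomp Require Import ring zify.
Import GRing.Theory.
Local Open Scope ring_scope.

(** Write [W_i] for the combination
    [Phi^0_i R_i + Phi^1_i R_(i+1) + Phi^2_i R_(i+2)] of polynomials of [F]
    (the family of rho), [G] for the family of rho-bar, and
    [Delta j k] for [zeta Yb_j - Y_k - xi].  The relation
    [lambda_F x = zeta lambda_G (x + eta) - xi] turns the recurrence of [G]
    into
      [(lambda_F x + xi) W_i = zeta (Ab_i W_(i+1) + Yb_i W_i + Cb_i W_(i-1))]
    for the functions [W_i = lambda^- R_i(x-bar; rho-bar)].  Expanding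
    [lambda_F x R_j] with the recurrence of [F], both sides become combinations
    of [R_(i-1)], ..., [R_(i+3)].  Those that exist are linearly independent
    on the [N + 1] points of the family ([Rval_free]); so contiguity amounts to
    the vanishing, for each [i <= Nb], of at most five coefficients
    ([residue]).

    The outer coefficients are first-order recursions that determine [Phi^0]
    from [Phi^0_0] and [Phi^2] from [Phi^2_0]; the middle one gives [Phi^1_i]
    upon division by [Delta i i.+1].  This is the normal form [g], [sol1],
    [sol2], with the one free parameter
    [kappa = Phi^2_0 / (Phi^0_0 A_0 A_1)] besides the global factor
    ([residue_unique]).  For that normal form the two remaining coefficients
    vanish exactly when the two expressions of the constraints are equal to
    [kappa] ([residue_solP]); at [i = 0] the first expression is an explicit
    value of [kappa], which yields the displayed [Phi^2_i].

    Conversely, vanishing coefficients propagate the relation from [i = 0],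
    where it defines [lambda^-], to all [i <= Nb], because [Ab_i != 0] for
    [i < Nb].  The recurrence at [i = Nb], where [Ab_Nb = 0], then says that
    at every point where [lambda^-] does not vanish, [lambda_G (x + eta)] is a
    root of the characteristic polynomial of [G], hence [x + eta] is one of
    the points of [G] ([residue_contiguous]). *)

Set Implicit Arguments.
Unset Strict Implicit.
Unset Printing Implicit Defensive.

(** * A single finite family *)

Section Family.
Context {K : fieldType}.
Implicit Types F : finite_family K.

Lemma mem_grid n m : (m <= n)%N -> m%:R \in grid K n.
Proof. by move=> le_mn; apply/mapP; exists m; rewrite ?mem_iota. Qed.

Lemma gridP n (x : K) : x \in grid K n -> exists2 m, (m <= n)%N & x = m%:R.
Proof. by case/mapP=> m; rewrite mem_iota => le_mn e; exists m. Qed.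

(** The images under [lambda] of the points [0], ..., [N]. *)
Definition spectrum F : seq K :=
  [seq ff_lambda F m%:R | m <- iota 0 (ff_N F).+1].

Lemma spectrumP F z : z \in spectrum F ->
  exists2 m, (m <= ff_N F)%N & z = ff_lambda F m%:R.
Proof. by case/mapP=> m; rewrite mem_iota => le_mN e; exists m. Qed.

Lemma spectrum_uniq F : uniq (spectrum F).
Proof.
rewrite map_inj_in_uniq ?iota_uniq // => m n; rewrite !mem_iota /= => hm hn e.
have shift k : k%:R = k.+1%:R - 1 :> K by rewrite -natr1 addrK.
by apply/succn_inj/(@ff_lambda_inj _ F); [lia | lia | rewrite -!shift].
Qed.

(** A polynomial of degree at most [N] is determined by its values at the
    points [lambda 0], ..., [lambda N]. *)
Lemma poly_grid_eq0 F (p : {poly K}) : (size p <= (ff_N F).+1)%N ->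
  (forall x, x \in grid K (ff_N F) -> p.[ff_lambda F x] = 0) -> p = 0.
Proof.
move=> szp p_eq0; apply: contraTeq isT => pn0.
have rs_root : all (root p) (spectrum F).
  by apply/allP=> x /spectrumP[m le_mN ->]; apply/rootP/p_eq0/mem_grid.
have := max_poly_roots pn0 rs_root (spectrum_uniq F).
by rewrite size_map size_iota ltnNge szp.
Qed.

(** For [a = A_i + C_i] and [b = C_i], this polynomial takes the values of
    [A_i R_(i+1)], by the recurrence. *)
Lemma size_recurrence F i a b : (i <= ff_N F)%N ->
  size ('X * ff_R F i + (a *: ff_R F i - b *: ff_R F i.-1)) = i.+2.
Proof.
move=> le_iN; have szi := @ff_size _ F i le_iN.
have szpi : (size (ff_R F i.-1) <= i.+1)%N by rewrite ff_size; lia.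
rewrite mulrC size_polyDl size_mulX ?szi // -?size_poly_gt0 ?szi //.
rewrite ltnS (leq_trans (size_polyD _ _)) // geq_max size_polyN.
by rewrite !(leq_trans (size_scale_leq _ _)) ?szi.
Qed.

(** If [A_i] were zero, the recurrence at [i < N] would be a polynomial
    relation of exact degree [i + 1] that holds at all the points. *)
Lemma ff_A_neq0 F i : (i < ff_N F)%N -> ff_A F i != 0.
Proof.
move=> lt_iN; apply/negP=> /eqP Ai0.
pose p : {poly K} :=
  'X * ff_R F i + (ff_C F i *: ff_R F i - ff_C F i *: ff_R F i.-1).
have szp : size p = i.+2 by rewrite size_recurrence ?(ltnW lt_iN).
suff p0 : p = 0 by move: szp; rewrite p0 size_poly0.
apply: (@poly_grid_eq0 F); first by rewrite szp.
move=> x _; rewrite /p !(hornerD, hornerN, hornerZ) hornerM hornerX.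
rewrite (@ff_rec _ F i x (ltnW lt_iN)); last by left.
by rewrite Ai0; ring.
Qed.

Lemma Rval_gt F i x : (ff_N F < i)%N -> Rval F i x = 0.
Proof. by rewrite /Rval ltnNge => /negbTE ->. Qed.

Lemma Rval0 F x : Rval F 0 x = 1.
Proof. by rewrite /Rval /= ff_R0 hornerE. Qed.

(** At [i = N] the value of [ff_R F N.+1] is replaced by 0; this is harmless
    since [A_N = 0]. *)
Lemma Rval_rec F i x : (i <= ff_N F)%N ->
  (i < ff_N F)%N \/ x \in grid K (ff_N F) ->
  ff_lambda F x * Rval F i x =
    ff_A F i * Rval F i.+1 x + Yc F i * Rval F i x + ff_C F i * Rval F i.-1 x.
Proof.
move=> le_iN hx; rewrite {1 3 4}/Rval /Yc le_iN (leq_trans (leq_pred i)) //.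
rewrite ff_rec //; move: le_iN; rewrite leq_eqVlt => /orP[/eqP->|lt_iN].
  by rewrite ff_AN; ring.
by rewrite /Rval lt_iN; ring.
Qed.

(** The recurrence closed at [i = N] characterizes the spectrum: its [N + 1]
    values are all the roots of the characteristic polynomial. *)
Lemma closed_rec_spectrum F x :
  ff_lambda F x * Rval F (ff_N F) x
    = Yc F (ff_N F) * Rval F (ff_N F) x
      + ff_C F (ff_N F) * Rval F (ff_N F).-1 x ->
  ff_lambda F x \in spectrum F.
Proof.
move=> closed; apply: contraTT isT => x_out.
pose p : {poly K} := 'X * ff_R F (ff_N F)
  + (- Yc F (ff_N F) *: ff_R F (ff_N F) - ff_C F (ff_N F) *: ff_R F (ff_N F).-1).
have szp : size p = (ff_N F).+2 by rewrite size_recurrence.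
have p_val y : p.[ff_lambda F y] = ff_lambda F y * Rval F (ff_N F) y
    - Yc F (ff_N F) * Rval F (ff_N F) y - ff_C F (ff_N F) * Rval F (ff_N F).-1 y.
  rewrite /p !(hornerD, hornerN, hornerZ) hornerM hornerX.
  by rewrite /Rval leqnn leq_pred; ring.
have pn0 : p != 0 by rewrite -size_poly_eq0 szp.
have rs_root : all (root p) (ff_lambda F x :: spectrum F).
  apply/allP=> z; rewrite inE => /predU1P[->|/spectrumP[m le_mN ->]];
    apply/rootP; rewrite p_val.
    by rewrite closed; ring.
  by rewrite Rval_rec ?ff_AN; [ring | | right; apply: mem_grid].
have rs_uniq : uniq (ff_lambda F x :: spectrum F).
  by rewrite cons_uniq x_out spectrum_uniq.
have := max_poly_roots pn0 rs_root rs_uniq.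
by rewrite szp -cat1s size_cat size_map size_iota ltnn.
Qed.

(** The functions [R_0], ..., [R_N] are linearly independent on the points of
    the family; [R_j] with [j > N] is zero, so its coefficient is free. *)
Lemma Rval_free F n m (b : nat -> K) :
  (forall x, x \in grid K (ff_N F) ->
     \sum_(k < n) b k * Rval F (m + k) x = 0) ->
  forall k, (k < n)%N -> (m + k <= ff_N F)%N -> b k = 0.
Proof.
elim: n => [//|n IHn] in b *; move=> hb k lt_kn le_kN.
pose p i := \sum_(k < i) (if (m + k <= ff_N F)%N then b k else 0)
   *: ff_R F (m + k).
have p_val x i : (p i).[ff_lambda F x] = \sum_(k < i) b k * Rval F (m + k) x.
  rewrite horner_sum; apply: eq_bigr => j _; rewrite hornerE /Rval.
  by case: ifP => _; rewrite ?mul0r ?mulr0.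
have sz_p i : (size (p i) <= minn (m + i) (ff_N F).+1)%N.
  apply: (leq_trans (size_sum _ _ _)); apply/bigmax_leqP => j _.
  case: ifP => hj; last by rewrite scale0r size_poly0.
  rewrite (leq_trans (size_scale_leq _ _)) // ff_size //.
  by have := ltn_ord j; lia.
have pS0 : p n.+1 = 0.
  apply: (@poly_grid_eq0 F) => [|x hx]; last by rewrite p_val hb.
  by apply: (leq_trans (sz_p _)); lia.
(* The summand of highest degree is alone in contributing to [X^(m + n)]. *)
have bn0 : (m + n <= ff_N F)%N -> b n = 0.
  move=> le_nN; have := congr1 (fun q : {poly K} => q`_(m + n)) pS0.
  rewrite /p big_ord_recr /= -/(p n) coefD coefZ coef0 le_nN.
  rewrite nth_default ?add0r; last by apply: (leq_trans (sz_p _)); lia.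
  move=> /eqP; rewrite mulf_eq0 => /orP[/eqP //|].
  have sz := @ff_size _ F _ le_nN.
  have -> : (ff_R F (m + n))`_(m + n) = lead_coef (ff_R F (m + n)).
    by rewrite lead_coefE sz.
  by rewrite lead_coef_eq0 -size_poly_eq0 sz.
have [eq_kn|ne_kn] := eqVneq k n; first by rewrite eq_kn bn0 -?eq_kn.
apply: (IHn b _ k _ le_kN) => [x hx|]; last by lia.
rewrite -[RHS](hb x hx) big_ord_recr /=.
have [/bn0->|gt_nN] := leqP (m + n) (ff_N F); first by rewrite mul0r addr0.
by rewrite Rval_gt // mulr0 addr0.
Qed.

End Family.

(** * The recurrence of one family on combinations of the other *)

Section Transport.
Context {K : fieldType}.
Variables (F G : finite_family K) (eta zeta xi : K).

Local Notation N := (ff_N F).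
Local Notation Nb := (ff_N G).
Local Notation A := (ff_A F).
Local Notation C := (ff_C F).
Local Notation Ab := (ff_A G).
Local Notation Cb := (ff_C G).
Local Notation X := (Xc F).
Local Notation Y := (Yc F).
Local Notation Xb := (Xc G).
Local Notation Yb := (Yc G).
Local Notation D := (Delta F G zeta xi).

(** Three-term combination of consecutive polynomials of the family [F]. *)
Definition combination (p0 p1 p2 : nat -> K) (i : nat) (x : K) : K :=
  p0 i * Rval F i x + p1 i * Rval F i.+1 x + p2 i * Rval F i.+2 x.

(** The coefficients of [R_(i-1)], ..., [R_(i+3)] (for [k = 0, ..., 4]) in the
    amount by which the combinations fail to satisfy the recurrence of the
    family [G], the multiplication by [lambda] being expanded with the
    recurrence of [F]. *)
Definition residue (p0 p1 p2 : nat -> K) (i k : nat) : K :=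
  nth 0
    [:: p0 i * C i - zeta * (Cb i * p0 i.-1);
        p1 i * C i.+1 - D i i * p0 i - zeta * (Cb i * p1 i.-1);
        p0 i * A i + p2 i * C i.+2 - D i i.+1 * p1 i
          - zeta * (Ab i * p0 i.+1 + Cb i * p2 i.-1);
        p1 i * A i.+1 - D i i.+2 * p2 i - zeta * (Ab i * p1 i.+1);
        p2 i * A i.+2 - zeta * (Ab i * p2 i.+1)]
    k.

(** The combinations only involve [R_j] with [j <= N]: beyond, [Rval] is 0 by
    convention and does not follow the recurrence. *)
Definition truncated (p1 p2 : nat -> K) : Prop :=
  (forall i, (N < i.+1)%N -> p1 i = 0) /\ (forall i, (N < i.+2)%N -> p2 i = 0).

Lemma combination_defect p0 p1 p2 i x :
  truncated p1 p2 -> (i <= N)%N -> (i.+2 < N)%N \/ x \in grid K N ->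
  (ff_lambda F x + xi) * combination p0 p1 p2 i x
    - zeta * (Ab i * combination p0 p1 p2 i.+1 x
              + Yb i * combination p0 p1 p2 i x
              + Cb i * combination p0 p1 p2 i.-1 x)
  = \sum_(k < 5) residue p0 p1 p2 i k * Rval F (i + k).-1 x.
Proof.
move=> [tr1 tr2] le_iN hx.
have rec q j : (j <= i.+2)%N -> ((N < j)%N -> q = 0) ->
    q * (ff_lambda F x * Rval F j x)
    = q * (A j * Rval F j.+1 x + Y j * Rval F j x + C j * Rval F j.-1 x).
  move=> le_j; case: (leqP j N) => [le_jN _|_ -> //]; last by rewrite !mul0r.
  by rewrite Rval_rec //; case: hx => [?|]; [left; lia | right].
have e0 := rec (p0 i) i ltac:(lia) ltac:(lia).
have e1 := rec (p1 i) i.+1 ltac:(lia) (tr1 i).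
have e2 := rec (p2 i) i.+2 ltac:(lia) (tr2 i).
rewrite !big_ord_recr big_ord0 /residue /= /combination.
have expand l (r0 r1 r2 : K) : (l + xi) * (p0 i * r0 + p1 i * r1 + p2 i * r2)
    = p0 i * (l * r0) + p1 i * (l * r1) + p2 i * (l * r2)
      + xi * (p0 i * r0 + p1 i * r1 + p2 i * r2) by ring.
rewrite {}expand e0 e1 e2 /Delta.
(* At [i = 0] the index [i.-1] stands for -1; there [C_0 = Cb_0 = 0]. *)
case: i {le_iN hx rec e0 e1 e2} => [|i] /=; first by rewrite !ff_C0; ring.
by rewrite addn0 addn1 addn2 addn3 addn4 /=; ring.
Qed.

Lemma residue_00 p0 p1 p2 : residue p0 p1 p2 0 0 = 0.
Proof. by rewrite /residue /= !ff_C0; ring. Qed.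

(** If the combinations satisfy the recurrence of [G] at [i] on the points of
    the family, the residue at every existing [R_j] vanishes. *)
Lemma residue_eq0 p0 p1 p2 i :
  truncated p1 p2 -> (i <= N)%N ->
  (forall x, x \in grid K N ->
     (ff_lambda F x + xi) * combination p0 p1 p2 i x
     = zeta * (Ab i * combination p0 p1 p2 i.+1 x
               + Yb i * combination p0 p1 p2 i x
               + Cb i * combination p0 p1 p2 i.-1 x)) ->
  forall k, (k < 5)%N -> (i + k <= N.+1)%N -> residue p0 p1 p2 i k = 0.
Proof.
move=> tr le_iN rec k lt_k5 le_ikN.
have sum0 x : x \in grid K N ->
    \sum_(k < 5) residue p0 p1 p2 i k * Rval F (i + k).-1 x = 0.
  by move=> hx; rewrite -combination_defect ?rec ?subrr //; right.
case: i le_iN {rec} sum0 le_ikN => [_|i _] sum0 le_ikN; last first.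
  exact: (@Rval_free _ F 5 i (residue p0 p1 p2 i.+1)).
case: k lt_k5 le_ikN => [|k] lt_k le_kN; first exact: residue_00.
apply: (@Rval_free _ F 4 0 (fun j => residue p0 p1 p2 0 j.+1)) => // x hx.
by rewrite -[RHS](sum0 x hx) [RHS]big_ord_recl residue_00 mul0r add0r.
Qed.

(** [residue] at [i <= Nb] does not depend on the coefficients beyond [Nb],
    because [Ab_Nb = 0]. *)
Lemma residue_ext p0 p1 p2 q0 q1 q2 :
  (forall i, (i <= Nb)%N -> [/\ p0 i = q0 i, p1 i = q1 i & p2 i = q2 i]) ->
  forall i k, (i <= Nb)%N -> residue p0 p1 p2 i k = residue q0 q1 q2 i k.
Proof.
move=> e i k le_i; have [e0 e1 e2] := e i le_i.
have [e0' e1' e2'] := e i.-1 (leq_trans (leq_pred i) le_i).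
rewrite /residue e0 e1 e2 e0' e1' e2'; move: le_i.
rewrite leq_eqVlt => /orP[/eqP->|lt_i]; first by rewrite ff_AN !mul0r.
by have [-> -> ->] := e i.+1 lt_i.
Qed.

Lemma residueZ c p0 p1 p2 i k :
  residue (fun j => c * p0 j) (fun j => c * p1 j) (fun j => c * p2 j) i k
  = c * residue p0 p1 p2 i k.
Proof.
rewrite /residue; case: k => [|[|[|[|[|k]]]]] /=; try by ring.
by rewrite !nth_nil mulr0.
Qed.

(** * The normal form of the coefficients *)

Hypothesis hgen : generic F G zeta xi.

Let zeta0 : zeta != 0. Proof. by case: hgen. Qed.
Let N2 : (2 <= N)%N. Proof. by case: (generic_bounds hgen). Qed.
Let leN : (N <= Nb.+2)%N. Proof. by case: (generic_bounds hgen); lia. Qed.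
Let leNb : (Nb <= N)%N. Proof. by case: (generic_bounds hgen). Qed.

Let A0 i : (i < N)%N -> A i != 0. Proof. exact: ff_A_neq0. Qed.
Let Ab0 i : (i < Nb)%N -> Ab i != 0. Proof. exact: ff_A_neq0. Qed.
Let X0 i : (0 < i)%N -> (i <= N)%N -> X i != 0.
Proof. by move=> i0 le_iN; case: hgen => _ + _ _ _ _; apply; lia. Qed.
Let C0 i : (0 < i)%N -> (i <= N)%N -> C i != 0.
Proof. by move=> i0 /(X0 i0); rewrite mulf_eq0 negb_or => /andP[]. Qed.
Let D0 i : (i <= Nb)%N -> (i < N)%N -> D i i.+1 != 0.
Proof. by case: hgen => _ _ _ + _ _; apply. Qed.

Local Notation g := (Phi0_minus F G zeta).

(** The weight [h_i], to which [Phi^2_i] is proportional up to a factor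
    [A_i A_(i+1)], is the solution of [zeta Ab_i h_(i+1) = A_i h_i] with
    [h_0 = 1]. *)
Definition upper_weight (i : nat) : K :=
  zeta ^- i * \prod_(0 <= n < i) (A n / Ab n).
Local Notation h := upper_weight.

Let g0 : g 0 = 1. Proof. by rewrite /Phi0_minus big_geq ?mulr1 ?expr0. Qed.
Let h0 : h 0 = 1.
Proof. by rewrite /upper_weight big_geq // mulr1 expr0 invr1. Qed.

Lemma Phi0_minusS i : (i < N)%N -> C i.+1 * g i.+1 = zeta * (Cb i.+1 * g i).
Proof.
move=> lt_i; have Ci := C0 (ltn0Sn i) lt_i.
rewrite /Phi0_minus big_nat_recr //= exprS; set w := \prod_(_ <= _ < _) _.
by field.
Qed.

Lemma upper_weightS i : (i < Nb)%N -> zeta * (Ab i * h i.+1) = A i * h i.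
Proof.
move=> lt_i; have Abi := Ab0 lt_i.
rewrite /upper_weight big_nat_recr //= exprS; set w := \prod_(_ <= _ < _) _.
have z0 := zeta0; have zi0 : zeta ^+ i != 0 by rewrite expf_neq0.
by field; rewrite zi0 z0 Abi.
Qed.

Lemma upper_weight_neq0 i : (i <= Nb)%N -> h i != 0.
Proof.
elim: i => [|i IHi] lt_i; first by rewrite h0 oner_eq0.
have := mulf_neq0 (A0 (leq_trans lt_i leNb)) (IHi (ltnW lt_i)).
by rewrite -(upper_weightS lt_i) !mulf_eq0 !negb_or => /and3P[].
Qed.

(** The weight [zeta^(2i) prod Xb_k / X_k] occurring in the constraints is
    [g_i / h_i]; here [h_i] is never zero, whereas [g_i] may be. *)
Lemma constr_weightE i : (i <= Nb)%N ->
  zeta ^+ (2 * i) * \prod_(1 <= k < i.+1) (Xb k / X k) * h i = g i.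
Proof.
elim: i => [|i IHi] lt_i; first by rewrite g0 h0 big_geq // muln0 !mulr1.
have lt_iN := leq_trans lt_i leNb.
have Ci := C0 (ltn0Sn i) lt_iN; have Abi := Ab0 lt_i; have Ai := A0 lt_iN.
have z0 := zeta0.
have -> : g i.+1 = zeta * Cb i.+1 / C i.+1 * g i.
  by apply: (mulfI Ci); rewrite Phi0_minusS //; field.
have -> : h i.+1 = A i / (zeta * Ab i) * h i.
  apply: (mulfI (mulf_neq0 z0 Abi)).
  by rewrite -mulrA upper_weightS //; field; rewrite z0 Abi.
rewrite -(IHi (ltnW lt_i)) big_nat_recr //= mulnS exprD /Xc /=.
set w := \prod_(_ <= _ < _) _; set z := _ ^+ (2 * i).
by field; rewrite z0 Abi Ai Ci.
Qed.

(** The two quotients from which the constraints and [Phi^1_i] are built. *)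
Definition ratio_U (i : nat) : K := (X i.+1 - zeta ^+ 2 * Xb i.+1) / D i i.+1.
Definition ratio_V (i : nat) : K := (X i.+2 - zeta ^+ 2 * Xb i) / D i i.+1.
Local Notation U := ratio_U.
Local Notation V := ratio_V.

Let X_last : X N.+1 = 0. Proof. by rewrite /Xc /= ff_AN mul0r. Qed.
Let Xb_last : Xb Nb.+1 = 0. Proof. by rewrite /Xc /= ff_AN mul0r. Qed.

Let U_end i : (i <= Nb)%N -> (N <= i)%N -> U i = 0.
Proof.
move=> le_i ge_i; have [eNb eN] : i = Nb /\ i = N by split; lia.
by rewrite /ratio_U {1}eN X_last {1}eNb Xb_last mulr0 subrr mul0r.
Qed.

(** With [g = Phi0_minus], the normal form of the solutions up to a global
    factor.  The factor [A_i] in [sol1] and [A_i A_(i+1)] in [sol2] replace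
    quotients by [A_(i+1)], so that for [i <= Nb] both formulas remain valid,
    with the value 0, where [R_(i+1)], resp. [R_(i+2)], does not exist. *)
Definition sol1 (kappa : K) (i : nat) : K :=
  U i / C i.+1 * g i + kappa * (V i * A i * h i).
Definition sol2 (kappa : K) (i : nat) : K := kappa * (A i * A i.+1 * h i).

Lemma C_sol1 k i : (i <= Nb)%N ->
  C i.+1 * sol1 k i = U i * g i + k * (X i.+1 * V i * h i).
Proof.
move=> le_i; rewrite /sol1 [X i.+1]/Xc /=.
have [lt_i|ge_i] := ltnP i N.
  by have Ci := C0 (ltn0Sn i) lt_i; field.
by rewrite U_end //; ring.
Qed.

Lemma D_sol1 k i : (i <= Nb)%N -> (i < N)%N ->
  D i i.+1 * sol1 k i
  = (X i.+1 - zeta ^+ 2 * Xb i.+1) / C i.+1 * g i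
    + k * ((X i.+2 - zeta ^+ 2 * Xb i) * A i * h i).
Proof.
move=> le_i lt_i; have Ci := C0 (ltn0Sn i) lt_i; have Di := D0 le_i lt_i.
by rewrite /sol1 /ratio_U /ratio_V; field; rewrite Ci Di.
Qed.

Lemma Cb_sol1 k i : (i < Nb)%N ->
  zeta * (Cb i.+1 * sol1 k i)
  = U i * g i.+1 + k * (zeta ^+ 2 * Xb i.+1 * V i * h i.+1).
Proof.
move=> lt_i; have lt_iN := leq_trans lt_i leNb.
have Ci := C0 (ltn0Sn i) lt_iN.
have eg := Phi0_minusS lt_iN; have eh := upper_weightS lt_i.
have -> : g i.+1 = zeta * (Cb i.+1 * g i) / C i.+1 by rewrite -eg; field.
have -> : zeta ^+ 2 * Xb i.+1 * V i * h i.+1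
    = zeta * Cb i.+1 * V i * (zeta * (Ab i * h i.+1)) by rewrite /Xc /=; ring.
by rewrite eh /sol1; field.
Qed.

Lemma residue_sol0 k i : (i <= Nb)%N -> residue g (sol1 k) (sol2 k) i 0 = 0.
Proof.
case: i => [|i] lt_i; first exact: residue_00.
by rewrite /residue /= -(Phi0_minusS (leq_trans lt_i leNb)); ring.
Qed.

(** The coefficient of [R_i] carries the first expression of the
    constraints. *)
Lemma residue_sol1 k i : (i <= Nb)%N ->
  residue g (sol1 k) (sol2 k) i 1
  = k * (constr1_den F G zeta xi i * h i) - constr1_num F G zeta xi i * g i.
Proof.
move=> le_i; rewrite /residue /= [sol1 k i * _]mulrC C_sol1 //.
rewrite /constr1_num /constr1_den -/(U i) -/(V i).
case: i le_i => [|i] lt_i.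
  by rewrite /Xc /= !ff_C0; ring.
by rewrite Cb_sol1 // -[i.+1.-1]/i -/(U i) -/(V i); ring.
Qed.

Lemma residue_sol2 k i : (i <= Nb)%N -> (i < N)%N ->
  residue g (sol1 k) (sol2 k) i 2 = 0.
Proof.
move=> le_i lt_iN; rewrite /residue /= D_sol1 // mulrDr.
have Ci := C0 (ltn0Sn i) lt_iN.
have -> : zeta * (Ab i * g i.+1) = zeta ^+ 2 * Xb i.+1 / C i.+1 * g i.
  have -> : g i.+1 = zeta * (Cb i.+1 * g i) / C i.+1.
    by rewrite -Phi0_minusS //; field.
  by rewrite /Xc /=; field.
have -> : zeta * (Cb i * sol2 k i.-1) = k * (zeta ^+ 2 * Xb i * A i * h i).
  case: i le_i {lt_iN Ci} => [|i] lt_i; first by rewrite /Xc ff_C0; ring.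
  have -> : zeta ^+ 2 * Xb i.+1 * A i.+1 * h i.+1
    = zeta * Cb i.+1 * A i.+1 * (zeta * (Ab i * h i.+1)) by rewrite /Xc /=; ring.
  by rewrite upper_weightS // /sol2 /=; ring.
by rewrite /sol2 /Xc /=; field.
Qed.

(** The coefficient of [R_(i+2)] carries the second expression of the
    constraints. *)
Lemma residue_sol3 k i : (i <= Nb)%N -> (i.+2 <= N)%N ->
  residue g (sol1 k) (sol2 k) i 3
  = A i.+1 / C i.+1 * (constr2_num F G zeta xi i * g i
                       - k * (constr2_den F G zeta xi i * h i)).
Proof.
move=> le_i lt_iN; rewrite /constr2_num /constr2_den -!/(U _) -!/(V _).
have Ci := C0 (ltn0Sn i) (ltnW lt_iN); have Ci1 := C0 (ltn0Sn i.+1) lt_iN.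
have Ai1 : A i.+1 != 0 := A0 lt_iN.
rewrite /residue /=.
have gS : g i.+1 = zeta * (Cb i.+1 * g i) / C i.+1.
  by rewrite -Phi0_minusS ?(ltnW lt_iN) //; field.
(* At [i = Nb] the recursion of [h] is not available, but then [i + 2 = N]
   and [V_(i+1)] vanishes, as does [Ab_i]. *)
have hS : zeta * (Ab i * (V i.+1 * h i.+1)) = A i * V i.+1 * h i.
  have [lt_i|ge_i] := ltnP i Nb.
    by rewrite -mulrA (mulrCA (A i)) -upper_weightS //; ring.
  have [eNb eN] : i = Nb /\ i.+2 = N by split; lia.
  have -> : V i.+1 = 0.
    by rewrite /ratio_V {1}eN X_last {1}eNb Xb_last mulr0 subrr mul0r.
  by ring.
have -> : zeta * (Ab i * sol1 k i.+1)
    = zeta * (Ab i * (U i.+1 / C i.+2 * g i.+1))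
      + k * A i.+1 * (zeta * (Ab i * (V i.+1 * h i.+1))).
  by rewrite /sol1; ring.
rewrite hS gS /sol1 /sol2 /Xc /=.
by field; rewrite Ci Ci1 Ai1.
Qed.

Lemma residue_sol4 k i : (i.+3 <= N)%N ->
  residue g (sol1 k) (sol2 k) i 4 = 0.
Proof.
move=> lt_iN; rewrite /residue /= /sol2.
have -> : zeta * (Ab i * (k * (A i.+1 * A i.+2 * h i.+1)))
   = k * (A i.+1 * A i.+2 * (zeta * (Ab i * h i.+1))) by ring.
by rewrite upper_weightS; [ring | lia].
Qed.

Lemma sol1_end kappa i : (i <= Nb)%N -> (N < i.+1)%N -> sol1 kappa i = 0.
Proof.
move=> le_i ge_i; have Ai : A i = 0 by rewrite (_ : i = N) ?ff_AN //; lia.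
by rewrite /sol1 U_end // Ai; ring.
Qed.

Lemma sol2_end kappa i : (i <= Nb)%N -> (N < i.+2)%N -> sol2 kappa i = 0.
Proof.
move=> le_i ge_i; rewrite /sol2.
have [->|->] : i = N \/ i.+1 = N by lia.
  by rewrite ff_AN; ring.
by rewrite ff_AN; ring.
Qed.

(** The recurrences determine the coefficients: [p0] and [p2] are obtained by
    going up from [i = 0], [p1] is then given by the coefficient of
    [R_(i+1)]. *)
Lemma residue_unique p0 p1 p2 : p0 0 != 0 -> truncated p1 p2 ->
  (forall i k, (i <= Nb)%N -> (k < 5)%N -> (i + k <= N.+1)%N ->
     residue p0 p1 p2 i k = 0) ->
  let c := p0 0 in let kappa := p2 0 / (c * (A 0 * A 1)) in
  forall i, (i <= Nb)%N ->
    [/\ p0 i = c * g i, p1 i = c * sol1 kappa i & p2 i = c * sol2 kappa i].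
Proof.
move=> c0 [tr1 tr2] res c kappa.
have e0 i : (i <= Nb)%N -> p0 i = c * g i.
  elim: i => [|i IHi] lt_i; first by rewrite g0 mulr1.
  have lt_iN := leq_trans lt_i leNb.
  apply: (mulfI (C0 (ltn0Sn i) lt_iN)).
  rewrite mulrCA Phi0_minusS // mulrCA (mulrCA c) -(IHi (ltnW lt_i)).
  have /eqP := res i.+1 0 lt_i isT ltac:(lia).
  by rewrite /residue /= subr_eq0 mulrC => /eqP.
have e2 i : (i <= Nb)%N -> p2 i = c * sol2 kappa i.
  move=> le_i; have [ge_i|] := ltnP N i.+2.
    by rewrite tr2 // sol2_end ?mulr0.
  elim: i {le_i} => [|i IHi] lt_iN.
    rewrite /sol2 h0 /kappa; have A00 := A0 (ltnW N2); have A01 := A0 N2.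
    by field; rewrite A00 A01 c0.
  have lt_i : (i < Nb)%N by lia.
  apply: (mulfI (mulf_neq0 zeta0 (Ab0 lt_i))).
  have /eqP := res i 4 (ltnW lt_i) isT ltac:(lia).
  rewrite /residue /= subr_eq0 mulrA => /eqP <-.
  rewrite (IHi (ltnW lt_iN)) /sol2.
  have -> : zeta * Ab i * (c * (kappa * (A i.+1 * A i.+2 * h i.+1)))
     = c * kappa * A i.+1 * A i.+2 * (zeta * (Ab i * h i.+1)) by ring.
  by rewrite upper_weightS //; ring.
move=> i le_i; split; [exact: e0 | | exact: e2].
have [lt_iN|ge_i] := ltnP i N; last first.
  by rewrite tr1 // sol1_end ?mulr0.
apply: (mulfI (D0 le_i lt_iN)).
have := residue_sol2 kappa le_i lt_iN; rewrite /residue /=.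
have := res i 2 le_i isT ltac:(lia); rewrite /residue /=.
have -> : Ab i * p0 i.+1 = c * (Ab i * g i.+1).
  move: le_i; rewrite leq_eqVlt => /orP[/eqP->|lt_i].
    by rewrite ff_AN !mul0r mulr0.
  by rewrite e0 // mulrCA.
rewrite e0 // !e2 // ?(leq_trans (leq_pred i)) //.
(* Both [p1] and the normal form solve the same equation, linear in the unknown
   [p1 i] with coefficient [D i i.+1]. *)
move=> r r_sol; apply/eqP; rewrite -subr_eq0; apply/eqP.
have := congr2 (fun y z => c * z - y) r r_sol; rewrite mulr0 subr0 => <-.
by ring.
Qed.

(** * Constraints and displayed coefficients *)

Lemma constr1_eqP kappa i : (i <= Nb)%N ->
  constr1 F G zeta xi i = kappa <->
  kappa * (constr1_den F G zeta xi i * h i) = constr1_num F G zeta xi i * g i.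
Proof.
move=> le_i; have hi := upper_weight_neq0 le_i.
have di : constr1_den F G zeta xi i != 0 by case: hgen => _ _ _ _ + _; apply.
rewrite -constr_weightE // /constr1; set w := \prod_(_ <= _ < _) _.
split=> [<-|e]; first by field.
by apply: (mulIf (mulf_neq0 di hi)); rewrite e; field.
Qed.

Lemma constr2_eqP kappa i : (i.+2 <= N)%N ->
  constr2 F G zeta xi i = kappa <->
  kappa * (constr2_den F G zeta xi i * h i) = constr2_num F G zeta xi i * g i.
Proof.
move=> lt_i; have le_i : (i <= Nb)%N by lia.
have hi := upper_weight_neq0 le_i.
have di : constr2_den F G zeta xi i != 0 by case: hgen => _ _ _ _ _ ->.
rewrite -constr_weightE // /constr2; set w := \prod_(_ <= _ < _) _.
split=> [<-|e]; first by field.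
by apply: (mulIf (mulf_neq0 di hi)); rewrite e; field.
Qed.

(** The normal form solves the equations exactly when both expressions of the
    constraints are equal to its parameter. *)
Lemma residue_solP kappa :
  (forall i k, (i <= Nb)%N -> (k < 5)%N -> (i + k <= N.+1)%N ->
     residue g (sol1 kappa) (sol2 kappa) i k = 0) <->
  (forall i, (i <= Nb)%N -> constr1 F G zeta xi i = kappa) /\
  (forall i, (i.+2 <= N)%N -> constr2 F G zeta xi i = kappa).
Proof.
split=> [res|[c1 c2] i k le_i].
  split=> i hi.
    apply/constr1_eqP => //; apply/eqP; rewrite -subr_eq0 -residue_sol1 //.
    by rewrite res //; lia.
  have le_i : (i <= Nb)%N by lia.
  apply/constr2_eqP => //; apply/esym/eqP; rewrite -subr_eq0.
  have := res i 3 le_i isT ltac:(lia); rewrite residue_sol3 // => /eqP.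
  by rewrite mulf_eq0 mulf_eq0 invr_eq0 (negbTE (A0 hi)) (negbTE (C0 _ _)) ?(ltnW hi).
case: k => [|[|[|[|[|//]]]]] _ le_k.
- exact: residue_sol0.
- by rewrite residue_sol1 // (constr1_eqP _ le_i).1 ?c1 // subrr.
- by rewrite residue_sol2 //; lia.
- by rewrite residue_sol3 ?(constr2_eqP _ _).1 ?c2 ?subrr ?mulr0 //; lia.
- by rewrite residue_sol4 //; lia.
Qed.

(** The displayed coefficients are the normal form for this parameter. *)
Local Notation kappa0 := (constr1 F G zeta xi 0).

Lemma constr1_0E :
  kappa0 = (D 0 0 * D 0 1 - (X 1 - zeta ^+ 2 * Xb 1)) / (X 1 * X 2).
Proof.
have X1 := X0 (ltn0Sn 0) (ltnW N2); have X2 := X0 (ltn0Sn 1) N2.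
have D1 := D0 (leq0n Nb) (ltnW N2).
rewrite /constr1 /constr1_num /constr1_den big_geq // muln0 expr0.
have -> : X 0 = 0 by rewrite /Xc ff_C0 mulr0.
have -> : Xb 0 = 0 by rewrite /Xc ff_C0 mulr0.
rewrite !(mulr0, oppr0, mul0r, subr0, mul1r, mulr1, add0r).
by field; rewrite X1 X2 D1.
Qed.

Lemma Phi2_minusE i : (i.+2 <= N)%N -> Phi2_minus F G zeta xi i = sol2 kappa0 i.
Proof.
move=> lt_i; have A00 := A0 (ltnW N2); have A01 := A0 N2.
have C1 := C0 (ltn0Sn 0) (ltnW N2); have C2 := C0 (ltn0Sn 1) N2.
have prodE j : A 0 * A 1 * \prod_(0 <= n < j) (A n.+2 / Ab n)
    = A j * A j.+1 * \prod_(0 <= n < j) (A n / Ab n).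
  elim: j => [|j IHj]; first by rewrite !big_geq.
  rewrite !big_nat_recr //= mulrA IHj; ring.
rewrite /Phi2_minus /sol2 constr1_0E /upper_weight.
have -> : \prod_(0 <= n < i) (A n.+2 / Ab n)
    = A i * A i.+1 * \prod_(0 <= n < i) (A n / Ab n) / (A 0 * A 1).
  by rewrite -prodE; field; rewrite A00 A01.
rewrite /Delta /Xc /=; set w := \prod_(_ <= _ < _) _; set z := zeta ^- i.
by field; rewrite A00 A01 C1 C2.
Qed.

Lemma Phi1_minusE i : (i.+2 <= N)%N -> Phi1_minus F G zeta xi i = sol1 kappa0 i.
Proof.
move=> lt_i; rewrite /Phi1_minus Phi2_minusE // /sol1 /sol2 /ratio_U /ratio_V.
have Ai1 := A0 lt_i; have Ci := C0 (ltn0Sn i) (ltnW lt_i).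
have Di : D i i.+1 != 0 by apply: D0; lia.
by field; rewrite Ai1 Ci Di.
Qed.

Lemma Phi1_minus_lastE i : (i <= Nb)%N -> i.+1 = N ->
  Phi1_minus_last F G zeta xi i = sol1 kappa0 i.
Proof.
move=> le_i eN; have lt_i : (i < N)%N by rewrite -eN.
have Ci := C0 (ltn0Sn i) lt_i; have Di := D0 le_i lt_i.
case: i => [|i] in eN le_i lt_i Ci Di *; first by have := N2; rewrite -eN.
rewrite /Phi1_minus_last Phi2_minusE /=; last by rewrite eN.
rewrite /sol1 /sol2 /ratio_U /ratio_V /=.
have Abi := Ab0 le_i; have z0 := zeta0.
have -> : kappa0 * (A i * A i.+1 * h i) = kappa0 * A i.+1 * (A i * h i) by ring.
by rewrite -upper_weightS //; field; rewrite Ci Di Abi z0.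
Qed.

Lemma lambda_minusE x :
  lambda_minus F G zeta xi x = combination g (sol1 kappa0) (sol2 kappa0) 0 x.
Proof.
have A00 := A0 (ltnW N2); have A01 := A0 N2.
have C1 := C0 (ltn0Sn 0) (ltnW N2); have C2 := C0 (ltn0Sn 1) N2.
have D1 := D0 (leq0n Nb) (ltnW N2).
have /esym := Rval_rec (ltnW (ltnW N2)) (or_introl (x \in grid K N) (ltnW N2)).
have /esym := Rval_rec (ltnW N2) (or_introl (x \in grid K N) N2).
rewrite ff_C0 mul0r addr0 Rval0 !mulr1.
move=> r2 r1.
have {}r1 : Rval F 1 x = (ff_lambda F x - Y 0) / A 0 by rewrite -r1; field.
have {}r2 : Rval F 2 x = ((ff_lambda F x - Y 1) * Rval F 1 x - C 1) / A 1.
  have -> : (ff_lambda F x - Y 1) * Rval F 1 x = A 1 * Rval F 2 x + C 1.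
    by rewrite mulrBl -r2; ring.
  by field.
have s1 : sol1 kappa0 0 = D 0 0 / C 1.
  rewrite /sol1 /ratio_U /ratio_V g0 h0 constr1_0E.
  have -> : Xb 0 = 0 by rewrite /Xc ff_C0 mulr0.
  by rewrite /Xc /=; field; rewrite A00 A01 C1 C2 D1.
rewrite /combination r2 r1 s1 Rval0 g0 /sol2 h0 constr1_0E.
rewrite /lambda_minus /Delta /Xc /=.
by field; rewrite A00 A01 C1 C2.
Qed.

(** * Equivalence of contiguity with the vanishing of the residues *)

Hypothesis hlambda : forall x : K,
  ff_lambda F x = zeta * ff_lambda G (x + eta) - xi.

Lemma Rval_rec_shift i x : (i <= Nb)%N -> (i < Nb)%N \/ x + eta \in grid K Nb ->
  (ff_lambda F x + xi) * Rval G i (x + eta)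
  = zeta * (Ab i * Rval G i.+1 (x + eta) + Yb i * Rval G i (x + eta)
            + Cb i * Rval G i.-1 (x + eta)).
Proof. by move=> le_i hx; rewrite -Rval_rec // hlambda; ring. Qed.

Section Coefficients.
Variables (lambdam : K -> K) (p0 p1 p2 : nat -> K).
Hypothesis tr : truncated p1 p2.

(** Contiguity in terms of truncated coefficients. *)
Definition contiguous : Prop :=
  (forall (i : nat) (x : K), (i <= Nb)%N -> (i.+2 <= N)%N \/ x \in grid K N ->
     lambdam x * Rval G i (x + eta) = combination p0 p1 p2 i x) /\
  (forall x : K, x \in grid K N -> x + eta \notin grid K Nb -> lambdam x = 0).

Lemma contiguous_residue : contiguous ->
  forall i k, (i <= Nb)%N -> (k < 5)%N -> (i + k <= N.+1)%N ->
    residue p0 p1 p2 i k = 0.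
Proof.
move=> [ctg van] i k le_i; apply: residue_eq0 => //; first exact: leq_trans leNb.
move=> x hx.
have ctg' j : (j <= Nb)%N ->
    combination p0 p1 p2 j x = lambdam x * Rval G j (x + eta).
  by move=> le_j; rewrite ctg //; right.
(* At [i = Nb] contiguity says nothing on index [i + 1], but [Ab_Nb = 0]. *)
have top : Ab i * combination p0 p1 p2 i.+1 x
    = lambdam x * (Ab i * Rval G i.+1 (x + eta)).
  move: le_i; rewrite leq_eqVlt => /orP[/eqP->|lt_i].
    by rewrite ff_AN; ring.
  by rewrite ctg' //; ring.
rewrite top !ctg' ?(leq_trans (leq_pred i)) //.
have [hxe|hxe] := boolP (x + eta \in grid K Nb); last first.
  by rewrite van //; ring.
rewrite mulrCA Rval_rec_shift //; last by right.
by ring.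
Qed.

Lemma combination_rec :
  (forall i k, (i <= Nb)%N -> (k < 5)%N -> (i + k <= N.+1)%N ->
     residue p0 p1 p2 i k = 0) ->
  forall i x, (i <= Nb)%N -> (i.+2 < N)%N \/ x \in grid K N ->
    (ff_lambda F x + xi) * combination p0 p1 p2 i x
    = zeta * (Ab i * combination p0 p1 p2 i.+1 x
              + Yb i * combination p0 p1 p2 i x
              + Cb i * combination p0 p1 p2 i.-1 x).
Proof.
move=> res i x le_i hx; apply/eqP; rewrite -subr_eq0; apply/eqP.
rewrite combination_defect ?(leq_trans le_i) // big1 // => k _.
have [le_k|gt_k] := leqP (i + k) N.+1; first by rewrite res // mul0r.
by rewrite Rval_gt ?mulr0 //; lia.
Qed.

(** The points [m - eta] with [m <= Nb <= N] are among the points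
    [-1, 0, ..., N + 1] that [lambda] separates. *)
Lemma shift_natr m : eta \in [:: 0; 1; -1] ->
  exists2 m', (m' <= m.+2)%N & m%:R - eta = m'%:R - 1.
Proof.
rewrite !inE => /or3P[] /eqP->.
- by exists m.+1; rewrite // -natr1; ring.
- by exists m => //; lia.
- by exists m.+2; rewrite // -!natr1; ring.
Qed.

(** The relation propagates from [i = 0] by the recurrence.  At a point where
    [lambda^-] does not vanish, the recurrence of [G] closed at [Nb] then
    holds, so that the point belongs to the family [G]. *)
Lemma residue_contiguous : eta \in [:: 0; 1; -1] ->
  (forall i k, (i <= Nb)%N -> (k < 5)%N -> (i + k <= N.+1)%N ->
     residue p0 p1 p2 i k = 0) ->
  (forall x, lambdam x = combination p0 p1 p2 0 x) ->
  contiguous.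
Proof.
move=> heta res lam.
pose ctg i := (i <= Nb)%N -> forall x, (i.+2 <= N)%N \/ x \in grid K N ->
  lambdam x * Rval G i (x + eta) = combination p0 p1 p2 i x.
have all_ctg i : ctg i.
  suff: ctg i.-1 /\ ctg i by case.
  elim: i => [|i [IHp IHi]].
    by split=> _ x _; rewrite Rval0 mulr1 lam.
  split=> // lt_i x hx.
  have hx' : (i.+2 <= N)%N \/ x \in grid K N by case: hx; [left; lia | right].
  have hxp : (i.-1.+2 <= N)%N \/ x \in grid K N by case: hx; [left; lia | right].
  have := combination_rec res (ltnW lt_i) hx.
  rewrite -IHi ?(ltnW lt_i) // -IHp ?(leq_trans (leq_pred i) (ltnW lt_i)) //.
  rewrite mulrCA Rval_rec_shift ?(ltnW lt_i) //; last by left.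
  move=> e; apply: (mulfI (mulf_neq0 zeta0 (Ab0 lt_i))).
  set S1 := Rval G i.+1 _ in e *; set S := Rval G i _ in e *.
  set Sp := Rval G i.-1 _ in e *; set W := combination _ _ _ _ _ in e *.
  pose rest := zeta * (Yb i * (lambdam x * S) + Cb i * (lambdam x * Sp)).
  apply: (@addIr _ rest); rewrite /rest.
  transitivity (lambdam x * (zeta * (Ab i * S1 + Yb i * S + Cb i * Sp))).
    by ring.
  by rewrite e; ring.
split=> [i x le_i hx|x hx]; first exact: all_ctg.
apply: contraNeq => lam0.
have hx' i : (i.+2 <= N)%N \/ x \in grid K N by right.
have closed : ff_lambda G (x + eta) * Rval G Nb (x + eta)
    = Yb Nb * Rval G Nb (x + eta) + Cb Nb * Rval G Nb.-1 (x + eta).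
  apply: (mulfI (mulf_neq0 zeta0 lam0)).
  have := combination_rec res (leqnn Nb) (or_intror hx).
  rewrite -(all_ctg Nb (leqnn _) x (hx' _)) -(all_ctg _ (leq_pred _) x (hx' _)).
  rewrite ff_AN mul0r add0r hlambda.
  set S := Rval G Nb _; set Sp := Rval G Nb.-1 _; set l := ff_lambda G _ => e.
  transitivity ((zeta * l - xi + xi) * (lambdam x * S)); first by ring.
  by rewrite e; ring.
have [m le_m e] := spectrumP (closed_rec_spectrum closed).
have [n le_n xn] := gridP hx.
have [m' le_m' em] := shift_natr m heta.
have : ff_lambda F (n.+1%:R - 1) = ff_lambda F (m'%:R - 1).
  by rewrite -em -natr1 addrK -xn !hlambda subrK e.
move=> /(@ff_lambda_inj _ F _ _) en.
have {}en : n.+1 = m' by apply: en; lia.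
by rewrite xn -[n%:R](addrK 1) natr1 en -em subrK mem_grid.
Qed.

End Coefficients.

(** Contiguity only sees [Phi^1_i] and [Phi^2_i] where [R_(i+1)], resp.
    [R_(i+2)], exists, so that these coefficients may be truncated. *)
Lemma contiguity_minusP (lambdam : K -> K) (Phi0 Phi1 Phi2 : nat -> K) :
  contiguity_minus F G eta lambdam Phi0 Phi1 Phi2 <->
  contiguous lambdam Phi0 (fun i => if (i.+1 <= N)%N then Phi1 i else 0)
    (fun i => if (i.+2 <= N)%N then Phi2 i else 0).
Proof.
have e i x : combination Phi0 (fun i => if (i.+1 <= N)%N then Phi1 i else 0)
    (fun i => if (i.+2 <= N)%N then Phi2 i else 0) i x
  = Phi0 i * Rval F i x + Phi1 i * Rval F i.+1 x + Phi2 i * Rval F i.+2 x.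
  rewrite /combination; congr (_ + _ + _).
    by case: ltnP => // ?; rewrite Rval_gt ?mulr0.
  by case: ltnP => // ?; rewrite Rval_gt ?mulr0.
by split=> -[ctg van]; split=> // i x le_i hx; rewrite ctg.
Qed.

Lemma coefficients_minusP c (lambdam : K -> K) (Phi0 Phi1 Phi2 : nat -> K) :
  coefficients_minus F G zeta xi c lambdam Phi0 Phi1 Phi2 <->
  (forall x, lambdam x
     = c * combination g (sol1 kappa0) (sol2 kappa0) 0 x) /\
  (forall i, (i <= Nb)%N ->
     [/\ Phi0 i = c * g i,
         (if (i.+1 <= N)%N then Phi1 i else 0) = c * sol1 kappa0 i
       & (if (i.+2 <= N)%N then Phi2 i else 0) = c * sol2 kappa0 i]).
Proof.
split=> [[lam c0 c2 c1 c1']|[lam sol]].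
  split=> [x|i le_i]; first by rewrite lam lambda_minusE.
  split; first exact: c0.
    have [lt_i|ge_i] := leqP i.+1 N; last by rewrite sol1_end ?mulr0.
    have [lt_i2|ge_i2] := leqP i.+2 N; first by rewrite c1 ?Phi1_minusE.
    by rewrite c1' ?Phi1_minus_lastE //; lia.
  have [lt_i|ge_i] := leqP i.+2 N; first by rewrite c2 ?Phi2_minusE.
  by rewrite sol2_end ?mulr0.
have le_i i : (i.+2 <= N)%N -> (i <= Nb)%N by lia.
split=> [x|i hi|i hi|i hi|i hi eN].
- by rewrite lam lambda_minusE.
- by case: (sol i hi).
- by case: (sol i (le_i i hi)) => _ _; rewrite hi Phi2_minusE.
- by case: (sol i (le_i i hi)) => _ + _; rewrite (ltnW hi) Phi1_minusE.
- by case: (sol i hi) => _ + _; rewrite Phi1_minus_lastE // {1}eN leqnn.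
Qed.

Lemma contiguity_minus_iff (lambdam : K -> K) (Phi0 Phi1 Phi2 : nat -> K) :
  eta \in [:: 0; 1; -1] ->
  (Phi0 0 != 0 /\ contiguity_minus F G eta lambdam Phi0 Phi1 Phi2) <->
  ((exists c : K, c != 0 /\
      coefficients_minus F G zeta xi c lambdam Phi0 Phi1 Phi2) /\
   constraints_B2' F G zeta xi).
Proof.
move=> heta; pose p1 i := if (i.+1 <= N)%N then Phi1 i else 0.
pose p2 i := if (i.+2 <= N)%N then Phi2 i else 0.
have tr : truncated p1 p2.
  by split=> i; rewrite /p1 /p2 ltnNge => /negbTE ->.
have scale c kappa :
    (forall i, (i <= Nb)%N ->
      [/\ Phi0 i = c * g i, p1 i = c * sol1 kappa i & p2 i = c * sol2 kappa i]) ->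
    forall i k, (i <= Nb)%N ->
      residue Phi0 p1 p2 i k = c * residue g (sol1 kappa) (sol2 kappa) i k.
  by move=> sol i k le_i; rewrite (residue_ext sol) // residueZ.
split=> [[c0 /contiguity_minusP ctg]|[[c [c0 /coefficients_minusP[lam sol]]]]].
  rewrite -/p1 -/p2 in ctg; have res := contiguous_residue tr ctg.
  have [kappa sol] : exists kappa, forall i, (i <= Nb)%N ->
      [/\ Phi0 i = Phi0 0 * g i, p1 i = Phi0 0 * sol1 kappa i
        & p2 i = Phi0 0 * sol2 kappa i].
    by eexists; apply: residue_unique c0 tr res.
  have res_sol i k : (i <= Nb)%N -> (k < 5)%N -> (i + k <= N.+1)%N ->
      residue g (sol1 kappa) (sol2 kappa) i k = 0.
    move=> le_i lt_k le_k; apply/eqP; rewrite -(mulrI_eq0 _ (mulfI c0)).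
    by rewrite -scale // res.
  have /residue_solP[constr1_kappa constr2_kappa] := res_sol.
  have ekappa := constr1_kappa 0 (leq0n _).
  split; last by exists kappa.
  exists (Phi0 0); split=> //; apply/coefficients_minusP; rewrite ekappa.
  split=> // x.
  have := (ctg.1 0 x (leq0n _) (or_introl N2)).
  rewrite Rval0 mulr1 => ->; have [e0 e1 e2] := sol 0 (leq0n _).
  by rewrite /combination {1}e0 e1 e2; ring.
move=> [kappa [constr1_kappa constr2_kappa]].
have ekappa := constr1_kappa 0 (leq0n _); rewrite {}ekappa in lam sol.
have {}sol i : (i <= Nb)%N ->
    [/\ Phi0 i = c * g i, p1 i = c * sol1 kappa i & p2 i = c * sol2 kappa i].
  exact: sol.
have [e0 e1 e2] := sol 0 (leq0n _).
split; first by rewrite e0 g0 mulr1.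
apply/contiguity_minusP; rewrite -/p1 -/p2.
apply: residue_contiguous => // [i k le_i lt_k le_k|x].
  by rewrite (scale _ _ sol) // (residue_solP kappa).2 ?mulr0.
by rewrite lam /combination e0 e1 e2; ring.
Qed.

End Transport.

Theorem proposition2p11 (K : fieldType) (P : Type)
    (family : P -> finite_family K) (rho rhobar : P) (eta zeta xi : K)
    (heta : eta \in [:: 0; 1; -1])
    (hgen : generic (family rho) (family rhobar) zeta xi)
    (hlambda : forall x : K,
       ff_lambda (family rho) x =
         zeta * ff_lambda (family rhobar) (x + eta) - xi)
    (lambdam : K -> K) (Phi0 Phi1 Phi2 : nat -> K) :
  (Phi0 0%N != 0 /\
   contiguity_minus (family rho) (family rhobar) eta lambdam Phi0 Phi1 Phi2)
  <->
  ((exists c : K, c != 0 /\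
      coefficients_minus (family rho) (family rhobar) zeta xi
        c lambdam Phi0 Phi1 Phi2) /\
   constraints_B2' (family rho) (family rhobar) zeta xi).
Proof. exact: contiguity_minus_iff. Qed.
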